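(* Let $\mathcal{A}$ and $\mathcal{B}$ be $C^{*}$-algebras, let $\Xi$ be a Hilbert $\mathcal{A}$-module and $\nabla$ a Hilbert $\mathcal{B}$-module. Let $f:\Xi \rightarrow \nabla$ be a mapping for which there exists a function $\varphi:\Xi^{3}\rightarrow[0,\infty)$ such that $$\| f(\mu x+y)-\mu f(x)-f(y)\| \leq \varphi(x,y,0)$$ and $$\| f(\langle x,y\rangle z)-\langle f(x),f(y)\rangle f(z)\| \leq \varphi(x,y,z)$$ for all $x,y,z\in\Xi$ and all $\mu\in\mathbb{T}$. If there exists $0\leq L<1$ such that $\varphi(x,y,z)\leq \frac{L}{8}\varphi(2x,2y,2z)$ for all $x,y,z\in\Xi$, then there exists a unique Hilbert $C^{*}$-module homomorphism $H:\Xi\rightarrow\nabla$ such that $$\|f(x)-H(x)\|\leq \frac{L}{8-8L}\varphi(x,x,0)$$ for all $x\in\Xi$.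
   Context: $\mathbb{T}=\{z\in\mathbb{C}:|z|=1\}$. For a $C^{*}$-algebra $\mathcal{A}$, a (left) Hilbert $\mathcal{A}$-module is a complex linear space $\Xi$ with a compatible left $\mathcal{A}$-module action ($\lambda(ax)=(\lambda a)x=a(\lambda x)$) and a map $\langle\cdot,\cdot\rangle:\Xi\times\Xi\to\mathcal{A}$ that is linear in the first variable, satisfies $\langle ax,y\rangle=a\langle x,y\rangle$, $\langle x,y\rangle^{*}=\langle y,x\rangle$, $\langle x,x\rangle\geq 0$ with equality iff $x=0$, and such that $\Xi$ is complete in the norm $\|x\|=\|\langle x,x\rangle\|^{1/2}$. For a Hilbert $\mathcal{A}$-module $\Xi$ and a Hilbert $\mathcal{B}$-module $\nabla$, a Hilbert $C^{*}$-module homomorphism is a $\mathbb{C}$-linear map $H:\Xi\to\nabla$ with $H(\langle x,y\rangle z)=\langle H(x),H(y)\rangle H(z)$ for all $x,y,z\in\Xi$. *)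

(* Defs.v *)
From HB Require Import structures.
From mathcomp Require Import all_boot all_order all_algebra.
From mathcomp Require Import reals.
From mathcomp Require Import complex.
Set Implicit Arguments. Unset Strict Implicit. Unset Printing Implicit Defensive.
Import Order.TTheory GRing.Theory Num.Theory.
Local Open Scope ring_scope.
Local Open Scope complex_scope.

Section Defs.
Variable R : realType.
Local Notation C := R[i].

Definition complete_wrt (V : lmodType C) (nrm : V -> R) : Prop :=
  forall u : nat -> V,
    (forall e : R, 0 < e -> exists N : nat, forall m n : nat,
        (N <= m)%N -> (N <= n)%N -> nrm (u m - u n) < e) ->
    exists l : V, forall e : R, 0 < e -> exists N : nat, forall n : nat,
        (N <= n)%N -> nrm (u n - l) < e.

Record cstar_axioms (A : lmodType C) (mul : A -> A -> A) (star : A -> A)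
    (nrm : A -> R) : Prop := {
  cs_mulA : forall a b c, mul a (mul b c) = mul (mul a b) c;
  cs_mulDl : forall a b c, mul (a + b) c = mul a c + mul b c;
  cs_mulDr : forall a b c, mul a (b + c) = mul a b + mul a c;
  cs_mulZl : forall (k : C) a b, mul (k *: a) b = k *: mul a b;
  cs_mulZr : forall (k : C) a b, mul a (k *: b) = k *: mul a b;
  cs_starK : forall a, star (star a) = a;
  cs_starD : forall a b, star (a + b) = star a + star b;
  cs_starZ : forall (k : C) a, star (k *: a) = conjc k *: star a;
  cs_starM : forall a b, star (mul a b) = mul (star b) (star a);
  cs_norm_ge0 : forall a, 0 <= nrm a;
  cs_norm_eq0 : forall a, nrm a = 0 -> a = 0;
  cs_normZ : forall (k : C) a, (nrm (k *: a))%:C = `|k| * (nrm a)%:C;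
  cs_normD : forall a b, nrm (a + b) <= nrm a + nrm b;
  cs_normM : forall a b, nrm (mul a b) <= nrm a * nrm b;
  cs_cstar : forall a, nrm (mul (star a) a) = nrm a ^+ 2;
  cs_complete : complete_wrt nrm
}.

Record cstar_algebra := CStarAlgebra {
  cs_sort :> lmodType C;
  cs_mul : cs_sort -> cs_sort -> cs_sort;
  cs_star : cs_sort -> cs_sort;
  cs_norm : cs_sort -> R;
  cs_ax : cstar_axioms cs_mul cs_star cs_norm
}.

Definition cs_pos (A : cstar_algebra) (a : A) : Prop :=
  exists b : A, a = cs_mul (cs_star b) b.

Definition hm_norm_of (A : cstar_algebra) (X : lmodType C) (ip : X -> X -> A)
  (x : X) : R := Num.sqrt (cs_norm (ip x x)).

Record hilmod_axioms (A : cstar_algebra) (X : lmodType C)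
    (act : A -> X -> X) (ip : X -> X -> A) : Prop := {
  hm_actDl : forall (a b : A) x, act (a + b) x = act a x + act b x;
  hm_actDr : forall (a : A) x y, act a (x + y) = act a x + act a y;
  hm_actM : forall (a b : A) x, act (cs_mul a b) x = act a (act b x);
  hm_actZl : forall (k : C) (a : A) x, k *: act a x = act (k *: a) x;
  hm_actZr : forall (k : C) (a : A) x, k *: act a x = act a (k *: x);
  hm_ipDl : forall x y z, ip (x + y) z = ip x z + ip y z;
  hm_ipZl : forall (k : C) x y, ip (k *: x) y = k *: ip x y;
  hm_ipA : forall (a : A) x y, ip (act a x) y = cs_mul a (ip x y);
  hm_ipC : forall x y, cs_star (ip x y) = ip y x;
  hm_ip_pos : forall x, cs_pos (ip x x);
  hm_ip_eq0 : forall x, ip x x = 0 <-> x = 0;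
  hm_complete : complete_wrt (hm_norm_of ip)
}.

Record hilmod (A : cstar_algebra) := HilMod {
  hm_sort :> lmodType C;
  hm_act : A -> hm_sort -> hm_sort;
  hm_ip : hm_sort -> hm_sort -> A;
  hm_ax : hilmod_axioms hm_act hm_ip
}.

Definition hm_norm (A : cstar_algebra) (X : hilmod A) (x : X) : R :=
  hm_norm_of (@hm_ip A X) x.

Definition hilmod_hom (A B : cstar_algebra) (X : hilmod A) (Y : hilmod B)
    (H : X -> Y) : Prop :=
  (forall x y : X, H (x + y) = H x + H y) /\
  (forall (k : C) (x : X), H (k *: x) = k *: H x) /\
  (forall x y z : X,
     H (hm_act (hm_ip x y) z) = hm_act (hm_ip (H x) (H y)) (H z)).

End Defs.

(* Main.v *)
Require Import Defs.
From HB Require Import structures.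
From mathcomp Require Import all_boot all_order all_algebra.
From mathcomp Require Import reals complex boolp classical_sets.
From mathcomp Require Import ring lra.
Import Order.TTheory GRing.Theory Num.Theory.
Local Open Scope ring_scope.
Set Implicit Arguments. Unset Strict Implicit. Unset Printing Implicit Defensive.

(** [H x] is the limit of [2^n f (x / 2^n)]. The contraction property of [phi]
    makes the increments geometric with ratio [L / 4], and
    [8^n phi (x / 2^n) (y / 2^n) (z / 2^n) <= L^n phi x y z] passes the triple
    product to the limit. The limit commutes with unimodular scalars, and these
    generate all complex scalars additively up to integer multiples, so it is
    linear without any continuity assumption.

    That [|x| = sqrt |<x, x>|] is a norm rests on the Cauchy-Schwarz inequality,
    which reduces to [|a^* a| <= |a^* a + b^* b|] in a C*-algebra. The latter is
    proved in a unital C*-algebra with squares of self-adjoint elements as the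
    positive cone: square roots come from the iteration [y' = (g + y^2) / 2],
    and the positivity of [u^* u] from Kaplansky's argument. A C*-algebra without
    unit is embedded in its algebra of multipliers. *)

(** * Null sequences and limits in normed groups *)

Section NullSequences.
Variable R : realType.
Implicit Types r s : nat -> R.

(** One-sided: for nonnegative sequences this is convergence to 0, and it passes to every sequence
    that is dominated from above. *)
Definition null_seq r :=
  forall e : R, 0 < e -> exists N : nat, forall n, (N <= n)%N -> r n < e.

Lemma null_seq_le r s : (forall n, r n <= s n) -> null_seq s -> null_seq r.
Proof.
move=> rs s0 e e0; have [N sN] := s0 e e0.
by exists N => n /sN; apply: le_lt_trans.
Qed.

Lemma null_seqD r s : null_seq r -> null_seq s -> null_seq (fun n => r n + s n).
Proof.
move=> r0 s0 e e0; have e2 : 0 < e / 2 by lra.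
have [N rN] := r0 _ e2; have [M sM] := s0 _ e2.
exists (maxn N M) => n; rewrite geq_max => /andP[/rN ? /sM ?]; lra.
Qed.

Lemma null_seqM c r : 0 <= c -> null_seq r -> null_seq (fun n => c * r n).
Proof.
move=> c0 r0 e e0; have c1 : 0 < c + 1 by lra.
have [N rN] := r0 _ (divr_gt0 e0 c1).
exists N => n /rN; rewrite ltr_pdivlMr// => rn.
have [|rn0] := leP (r n) 0; nra.
Qed.

Lemma null_seqM2 r s : (forall n, 0 <= r n) ->
  null_seq r -> null_seq s -> null_seq (fun n => r n * s n).
Proof.
move=> r_ge0 r0 s0 e e0; have [N rN] := r0 _ ltr01; have [M sM] := s0 _ e0.
exists (maxn N M) => n; rewrite geq_max => /andP[/rN ? /sM ?].
have := r_ge0 n; have [|sn0] := leP (s n) 0; nra.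
Qed.

Lemma null_seq_harmonic : null_seq (fun n => 2 / n.+1%:R).
Proof.
move=> e e0; have [N] : exists N : nat, 2 / e < N%:R.
  by exists (Num.bound (2 / e)); rewrite archi_boundP// divr_ge0// ltW.
rewrite ltr_pdivrMr// => HN; exists N => n Nn.
rewrite ltr_pdivrMr// (lt_le_trans HN)// mulrC ler_pM2l// ler_nat.
exact: leq_trans Nn _.
Qed.

(** A Bernoulli-type induction bounds [q ^+ n] by [(1 + n (1 - q))^-1], hence by a multiple of the
    harmonic sequence. *)
Lemma null_seq_expr q : 0 <= q -> q < 1 -> null_seq (fun n => q ^+ n).
Proof.
move=> q0 q1.
have bern n : q ^+ n * (1 + n%:R * (1 - q)) <= 1.
  elim: n => [|n IH]; first by rewrite expr0 mul0r addr0 mulr1.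
  apply: le_trans IH; rewrite exprS -subr_ge0.
  rewrite (_ : _ - _ = q ^+ n * (n.+1%:R * (1 - q) ^+ 2)); last by ring.
  by rewrite mulr_ge0 ?exprn_ge0// mulr_ge0// sqr_ge0.
have d0 : 0 < 1 - q by lra.
apply: (null_seq_le (s := fun n => (1 - q)^-1 * (2 / n.+1%:R))); last first.
  by apply: null_seqM null_seq_harmonic; rewrite invr_ge0 ltW.
move=> n; rewrite ler_pdivlMl// ler_pdivlMr// -natr1.
have := bern n; have := exprn_ge0 n q0.
have : q ^+ n <= 1 by rewrite exprn_ile1// ltW.
nra.
Qed.

Lemma null_seq_const c : null_seq (fun=> c) -> c <= 0.
Proof.
move=> c0; rewrite leNgt; apply/negP => /c0[N /(_ _ (leqnn N))].
by rewrite ltxx.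
Qed.

Lemma null_seq_subseq r (g : nat -> nat) : (forall n, (n <= g n)%N) ->
  null_seq r -> null_seq (fun n => r (g n)).
Proof.
move=> gn r0 e /r0[N rN]; exists N => n Nn; apply: rN.
exact: leq_trans Nn (gn n).
Qed.

End NullSequences.

Section NormLimits.
Variables (R : realType) (V : zmodType) (nrm : V -> R).

(** No scalars occur, so that C*-algebras, multiplier algebras and Hilbert modules share one theory
    of limits. *)
Record norm_axioms : Prop := {
  norm_ax_ge0 : forall a, 0 <= nrm a;
  norm_ax0 : nrm 0 = 0;
  norm_ax_eq0 : forall a, nrm a = 0 -> a = 0;
  norm_axN : forall a, nrm (- a) = nrm a;
  norm_axD : forall a b, nrm (a + b) <= nrm a + nrm b }.

Definition tends_to (u : nat -> V) (l : V) := null_seq (fun n => nrm (u n - l)).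

Hypothesis nx : norm_axioms.

Lemma norm_axB a b c : nrm (a - c) <= nrm (a - b) + nrm (b - c).
Proof. by have := norm_axD nx (a - b) (b - c); rewrite addrA subrK. Qed.

Lemma norm_axC a b : nrm (a - b) = nrm (b - a).
Proof. by rewrite -(norm_axN nx) opprB. Qed.

Lemma tends_to_unique u l m : tends_to u l -> tends_to u m -> l = m.
Proof.
move=> ul um; apply/subr0_eq/(norm_ax_eq0 nx)/le_anti.
rewrite (norm_ax_ge0 nx) andbT; apply: null_seq_const.
apply: null_seq_le (null_seqD ul um) => n.
by rewrite (norm_axC (u n) l); apply: norm_axB.
Qed.

Lemma tends_toD u v l m : tends_to u l -> tends_to v m ->
  tends_to (fun n => u n + v n) (l + m).
Proof.
move=> ul vm; apply: null_seq_le (null_seqD ul vm) => n.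
by rewrite opprD addrACA; apply: norm_axD.
Qed.

Lemma tends_to_near u v l : null_seq (fun n => nrm (u n - v n)) ->
  tends_to v l -> tends_to u l.
Proof.
by move=> uv vl; apply: null_seq_le (null_seqD uv vl) => n; apply: norm_axB.
Qed.

Lemma tends_to_le u l c d : (forall n, nrm (u n - c) <= d) -> tends_to u l ->
  nrm (l - c) <= d.
Proof.
move=> ud ul; rewrite -subr_le0; apply: null_seq_const.
apply: null_seq_le ul => n; rewrite (norm_axC (u n)).
by have := norm_axB l (u n) c; have := ud n; lra.
Qed.

Lemma tends_to_subseq u l (g : nat -> nat) : (forall n, (n <= g n)%N) ->
  tends_to u l -> tends_to (fun n => u (g n)) l.
Proof. by move=> gn ul; apply: (null_seq_subseq gn ul). Qed.

End NormLimits.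

Lemma tends_to_cst (R : realType) (V : zmodType) (nrm : V -> R) c :
  norm_axioms nrm -> tends_to nrm (fun=> c) c.
Proof. by move=> nx e e0; exists 0%N => n _; rewrite subrr (norm_ax0 nx). Qed.

Section Biadditive.
Variables (R : realType) (V1 V2 V3 : zmodType).
Variables (n1 : V1 -> R) (n2 : V2 -> R) (n3 : V3 -> R) (B : V1 -> V2 -> V3).
Hypotheses (nx1 : norm_axioms n1) (nx2 : norm_axioms n2) (nx3 : norm_axioms n3).
Hypothesis BDl : forall a b c, B (a + b) c = B a c + B b c.
Hypothesis BDr : forall a b c, B a (b + c) = B a b + B a c.
Hypothesis B_le : forall a b, n3 (B a b) <= n1 a * n2 b.

(** The difference splits as [B (u - l) (v - m) + B l (v - m) + B (u - l) m]. Additivity in each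
    slot suffices, which covers the sesquilinear inner product as well as products and actions. *)
Lemma tends_to_biadditive u v l m : tends_to n1 u l -> tends_to n2 v m ->
  tends_to n3 (fun n => B (u n) (v n)) (B l m).
Proof.
move=> ul vm.
have := null_seqD (null_seqM2 (fun n => norm_ax_ge0 nx1 _) ul vm)
  (null_seqD (null_seqM (norm_ax_ge0 nx1 l) vm) (null_seqM (norm_ax_ge0 nx2 m) ul)).
apply: null_seq_le => n; rewrite (mulrC (n2 m)).
have -> : B (u n) (v n) - B l m = B (u n - l) (v n - m) + (B l (v n - m) + B (u n - l) m).
  have -> : B (u n) (v n) = B (u n) (v n - m) + (B (u n - l) m + B l m).
    by rewrite -BDl subrK -BDr subrK.
  by rewrite addrA addrK [RHS]addrA -BDl subrK.
apply: le_trans (norm_axD nx3 _ _) (lerD (B_le _ _) _).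
exact: le_trans (norm_axD nx3 _ _) (lerD (B_le _ _) (B_le _ _)).
Qed.

End Biadditive.

Definition norm_cauchy (R : realType) (V : zmodType) (nrm : V -> R)
    (u : nat -> V) :=
  forall e : R, 0 < e -> exists N : nat, forall m n : nat,
    (N <= m)%N -> (N <= n)%N -> nrm (u m - u n) < e.

Definition norm_complete (R : realType) (V : zmodType) (nrm : V -> R) :=
  forall u : nat -> V, norm_cauchy nrm u -> exists l : V, tends_to nrm u l.

(** * Convergence from a telescoping majorant *)

Section DominatedIncrements.
Variables (R : realType) (V : zmodType) (nrm : V -> R).
Hypothesis nx : norm_axioms nrm.
Variables (u : nat -> V) (r : nat -> R).
Hypothesis u_incr : forall n, nrm (u n.+1 - u n) <= r n - r n.+1.
Hypothesis r_ge0 : forall n, 0 <= r n.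

Lemma dominated_sub n k : nrm (u (n + k)%N - u n) <= r n - r (n + k)%N.
Proof.
elim: k => [|k IH]; first by rewrite addn0 !subrr (norm_ax0 nx).
rewrite addnS; have := norm_axB nx (u (n + k).+1) (u (n + k)%N) (u n).
by have := u_incr (n + k)%N; lra.
Qed.

Lemma dominated_tends_to : norm_complete nrm -> null_seq r ->
  exists l, tends_to nrm u l /\ nrm (l - u 0%N) <= r 0%N.
Proof.
move=> cmpl r0.
have le_r n m : (n <= m)%N -> nrm (u m - u n) <= r n.
  move=> /subnKC <-; have := dominated_sub n (m - n).
  by have := r_ge0 (n + (m - n))%N; lra.
have [e e0|l ul] := cmpl u.
  have [N rN] := r0 _ e0; exists N => m n Nm Nn.
  have [nm|/ltnW mn] := leqP n m; first exact: le_lt_trans (le_r _ _ nm) (rN _ Nn).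
  by rewrite (norm_axC nx); apply: le_lt_trans (le_r _ _ mn) (rN _ Nm).
exists l; split=> //; apply: (tends_to_le nx _ ul) => n; exact: le_r.
Qed.

End DominatedIncrements.

(** * Positive elements of a unital C*-algebra *)

(** Complex scalars enter through a central embedding [sc] of the reals and a central skew-adjoint
    [iU] with square -1. The ring may be zero, as the multiplier algebra of the zero algebra is;
    hence the norm of [sc t] is only bounded by [t]. *)
Record unital_cstar (R : realType) (U : pzRingType) (sc : {rmorphism R -> U})
    (iU : U) (star : U -> U) (N : U -> R) : Prop := {
  us_norm : norm_axioms N;
  us_complete : norm_complete N;
  us_normM : forall a b, N (a * b) <= N a * N b;
  us_cstar : forall a, N (star a * a) = N a ^+ 2;
  us_starK : involutive star;
  us_starD : {morph star : a b / a + b};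
  us_starM : forall a b, star (a * b) = star b * star a;
  us_sc_comm : forall t a, GRing.comm a (sc t);
  us_sc_star : forall t, star (sc t) = sc t;
  us_sc_norm : forall t, 0 <= t -> N (sc t) <= t;
  us_i_comm : forall a, GRing.comm a iU;
  us_i_star : star iU = - iU;
  us_i_sqr : iU * iU = -1 }.

Section UnitalCstar.
Variables (R : realType) (U : pzRingType) (sc : {rmorphism R -> U}).
Variables (iU : U) (star : U -> U) (N : U -> R).
Hypothesis ax : unital_cstar sc iU star N.
Let nx := us_norm ax.
Implicit Types a b g h k s z : U.

Local Notation sa a := (star a = a).

Definition pos_elt h := exists2 s, sa s & h = s * s.

Lemma us_star0 : star 0 = 0.
Proof. by apply: (addrI (star 0)); rewrite -(us_starD ax) !addr0. Qed.

Lemma us_starN a : star (- a) = - star a.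
Proof. by apply/eqP; rewrite -addr_eq0 -(us_starD ax) addNr us_star0. Qed.

Lemma us_starB a b : star (a - b) = star a - star b.
Proof. by rewrite (us_starD ax) us_starN. Qed.

Lemma us_star1 : star 1 = 1.
Proof. by rewrite -(rmorph1 sc) (us_sc_star ax). Qed.

Lemma us_norm1 : N 1 <= 1.
Proof. by rewrite -(rmorph1 sc) (us_sc_norm ax). Qed.

Lemma us_norm_star a : N (star a) = N a.
Proof.
suff le_star b : N b <= N (star b).
  by apply/le_anti; rewrite le_star -{2}(us_starK ax a) le_star.
have := norm_ax_ge0 nx b; rewrite le_eqVlt => /orP[/eqP<-|b0].
  exact: norm_ax_ge0 nx _.
by rewrite -(ler_pM2r b0) -expr2 -(us_cstar ax) (us_normM ax).
Qed.

Lemma us_norm_sq s : sa s -> N (s * s) = N s ^+ 2.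
Proof. by move=> ss; rewrite -{1}ss (us_cstar ax). Qed.

Lemma us_norm_sc t a : 0 <= t -> N (sc t * a) <= t * N a.
Proof.
move=> t0; apply: le_trans (us_normM ax _ _) _.
by rewrite ler_wpM2r ?(norm_ax_ge0 nx)// (us_sc_norm ax).
Qed.

Lemma us_sa_sc t a : sa a -> sa (sc t * a).
Proof. by move=> aa; rewrite (us_starM ax) (us_sc_star ax) aa (us_sc_comm ax). Qed.

Lemma us_sa_comm a b : sa a -> sa b -> GRing.comm a b -> sa (a * b).
Proof. by move=> aa bb ab; rewrite (us_starM ax) aa bb ab. Qed.

Lemma us_sc_mul (r t : R) a b : (sc r * a) * (sc t * b) = sc (r * t) * (a * b).
Proof. by rewrite rmorphM -!mulrA (mulrA a) (us_sc_comm ax t a) -!mulrA. Qed.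

Lemma us_scV t a : t != 0 -> sc t * (sc t^-1 * a) = a.
Proof. by move=> t0; rewrite mulrA -rmorphM divff// rmorph1 mul1r. Qed.

Lemma us_half a : sc 2^-1 * (a + a) = a.
Proof.
have -> : a + a = sc 2 * a by rewrite (rmorphD sc 1 1) rmorph1 mulrDl !mul1r.
by rewrite mulrA -rmorphM mulVf ?pnatr_eq0// rmorph1 mul1r.
Qed.

Lemma tends_toM u v l m : tends_to N u l -> tends_to N v m ->
  tends_to N (fun n => u n * v n) (l * m).
Proof.
by apply: tends_to_biadditive => //; [exact: mulrDl|exact: mulrDr|exact: us_normM ax].
Qed.

(** * Square root of [1 - g] by iteration *)

Section Sqrt.
Variable g : U.
Hypotheses (g_sa : sa g) (g_le1 : N g <= 1).

(** A fixed point [y = (g + y^2) / 2] satisfies [(1 - y)^2 = 1 - g]. *)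
Fixpoint sqrt_iter n : U :=
  if n is m.+1 then sc 2^-1 * (g + sqrt_iter m * sqrt_iter m) else 0.

(** The scalar iteration for [g = 1], written as [1 - d], since
    [(1 + (1 - d)^2) / 2 = 1 - (d - d^2 / 2)]. It majorizes the iteration in the algebra. *)
Fixpoint sqrt_gap n : R :=
  if n is m.+1 then sqrt_gap m - sqrt_gap m ^+ 2 / 2 else 1.

Lemma sqrt_gap_bounds n : 0 <= sqrt_gap n <= 1.
Proof. by elim: n => [|n /andP[? ?]] /=; apply/andP; split; nra. Qed.

Lemma sqrt_gap_null : null_seq sqrt_gap.
Proof.
have gap_le n : sqrt_gap n.+1 * n.+2%:R <= 2.
  elim: n => [|n IH]; first by rewrite /= expr1n; lra.
  have /andP[] := sqrt_gap_bounds n.+1.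
  rewrite -[n.+3%:R]natr1 [sqrt_gap n.+2]/= -/(sqrt_gap n.+1).
  move: (sqrt_gap n.+1) (n.+2%:R) IH => d p dp d0 d1.
  (* Expanding this product gives [d (2 - d) (p + 1) <= 4 - d^2], which is the induction step. *)
  have : 0 <= (2 - d * p) * (2 - d) by apply: mulr_ge0; lra.
  by have := sqr_ge0 d; lra.
apply: null_seq_le (@null_seq_harmonic R) => -[|n]; first by rewrite /=; lra.
by rewrite ler_pdivlMr.
Qed.

Lemma sqrt_iter_comm z n : GRing.comm z g -> GRing.comm z (sqrt_iter n).
Proof.
move=> zg; elim: n => [|n IH] /=; first exact: commr0.
by apply: commrM; [exact: us_sc_comm ax _ _|apply: commrD => //; apply: commrM].
Qed.

Lemma sqrt_iter_commute n m : GRing.comm (sqrt_iter n) (sqrt_iter m).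
Proof. exact/sqrt_iter_comm/commr_sym/sqrt_iter_comm. Qed.

Lemma sqrt_iter_sa n : sa (sqrt_iter n).
Proof.
elim: n => [|n IH] /=; first exact: us_star0.
by rewrite us_sa_sc// (us_starD ax) g_sa (us_starM ax) IH.
Qed.

Lemma sqrt_iter_norm n : N (sqrt_iter n) <= 1 - sqrt_gap n.
Proof.
elim: n => [|n IH] /=; first by rewrite (norm_ax0 nx) subrr.
apply: le_trans (us_norm_sc _ _) _; first by lra.
have := norm_axD nx g (sqrt_iter n * sqrt_iter n).
rewrite us_norm_sq ?sqrt_iter_sa//.
have : N (sqrt_iter n) ^+ 2 <= (1 - sqrt_gap n) ^+ 2.
  by rewrite lerXn2r// nnegrE ?(norm_ax_ge0 nx)// (le_trans _ IH) ?(norm_ax_ge0 nx).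
by have := g_le1; lra.
Qed.

(** The iterates commute, so a difference of squares factors. The induction closes because
    [(d - d') (2 - d - d') / 2] is the next decrement of the gaps [d], [d']. *)
Lemma sqrt_iter_incr n :
  N (sqrt_iter n.+1 - sqrt_iter n) <= sqrt_gap n - sqrt_gap n.+1.
Proof.
elim: n => [|n IH].
  rewrite /= subr0 mulr0 addr0; apply: le_trans (us_norm_sc _ _) _; first by lra.
  by rewrite expr1n; have := g_le1; lra.
have -> : sqrt_iter n.+2 - sqrt_iter n.+1 =
    sc 2^-1 * ((sqrt_iter n.+1 - sqrt_iter n) * (sqrt_iter n.+1 + sqrt_iter n)).
  transitivity (sc 2^-1 * (g + sqrt_iter n.+1 * sqrt_iter n.+1) -
    sc 2^-1 * (g + sqrt_iter n * sqrt_iter n)); first by [].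
  rewrite -mulrBr opprD addrACA subrr add0r; congr (_ * _).
  by rewrite mulrDr !mulrBl (sqrt_iter_commute n n.+1) addrA subrK.
apply: le_trans (us_norm_sc _ _) _; first by lra.
have := us_normM ax (sqrt_iter n.+1 - sqrt_iter n) (sqrt_iter n.+1 + sqrt_iter n).
have Dle : N (sqrt_iter n.+1 + sqrt_iter n) <= 2 - sqrt_gap n.+1 - sqrt_gap n.
  have := norm_axD nx (sqrt_iter n.+1) (sqrt_iter n).
  by have := sqrt_iter_norm n; have := sqrt_iter_norm n.+1; lra.
have := ler_pM (norm_ax_ge0 nx _) (norm_ax_ge0 nx _) IH Dle.
rewrite [sqrt_gap n.+2]/= -/(sqrt_gap n.+1).
move: (N (_ * _)) (N _ * N _) => x y xy yx; move: xy yx.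
by rewrite [sqrt_gap n.+1]/=; lra.
Qed.

(** The limit of the iterates inherits their commutation with everything that commutes with [g],
    which lets roots of commuting elements be multiplied. The bound [N y <= 1] allows the
    construction to be repeated on [y]. *)
Lemma sqrt_one_sub : exists y,
  [/\ sa y, N y <= 1, forall z, GRing.comm z g -> GRing.comm z y
    & (1 - y) * (1 - y) = 1 - g].
Proof.
have gap_ge0 n : 0 <= sqrt_gap n by case/andP: (sqrt_gap_bounds n).
have [y [yl y1]] := dominated_tends_to nx sqrt_iter_incr gap_ge0
  (us_complete ax) sqrt_gap_null.
have yE : y = sc 2^-1 * (g + y * y).
  apply: (tends_to_unique nx (u := fun n => sqrt_iter n.+1)).
    exact: (tends_to_subseq (fun n => leqnSn n) yl).
  apply: tends_toM (tends_to_cst _ nx) _.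
  exact: (tends_toD nx (tends_to_cst _ nx) (tends_toM yl yl)).
exists y; split.
- apply: (tends_to_unique nx (u := sqrt_iter)) => //.
  apply: null_seq_le yl => n.
  by rewrite -{1}sqrt_iter_sa -us_starB us_norm_star.
- by move: y1; rewrite subr0.
- move=> z /sqrt_iter_comm zy.
  apply: (tends_to_unique nx (tends_toM (tends_to_cst z nx) yl)).
  have := tends_toM yl (tends_to_cst z nx).
  by apply: null_seq_le => n; rewrite zy.
- have y2 : y + y = g + y * y.
    by rewrite {1 2}yE -mulrDr us_half.
  rewrite mulrBl mul1r mulrBr mulr1 opprB.
  rewrite (_ : y * y = y + y - g); last by rewrite y2 addrC addKr.
  by rewrite (addrAC (y + y)) addrK addrA subrK.
Qed.

End Sqrt.

(** The element [a] is the real part of [z = a + i b], and commutation gives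
    [star z * z = a^2 + b^2]. *)
Lemma us_sqr_norm_le a b : sa a -> sa b -> GRing.comm a b ->
  N a ^+ 2 <= N (a * a + b * b).
Proof.
move=> aa bb ab; set z := a + iU * b.
have zs : star z = a - iU * b.
  by rewrite (us_starD ax) (us_starM ax) aa bb (us_i_star ax) mulrN (us_i_comm ax).
have zz : star z * z = a * a + b * b.
  rewrite zs mulrBl !mulrDr.
  have -> : a * (iU * b) = iU * b * a.
    by rewrite mulrA (us_i_comm ax a) -!mulrA ab.
  have -> : iU * b * (iU * b) = - (b * b).
    by rewrite mulrA -(mulrA iU) (us_i_comm ax b) mulrA (us_i_sqr ax) mulN1r mulNr.
  by rewrite opprD opprK addrA addrK.
rewrite -zz (us_cstar ax) lerXn2r ?nnegrE ?(norm_ax_ge0 nx)//.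
have -> : a = sc 2^-1 * (z + star z).
  by rewrite zs /z addrACA subrr addr0 us_half.
apply: le_trans (us_norm_sc _ _) _; first by lra.
by have := norm_axD nx z (star z); rewrite us_norm_star; lra.
Qed.

Lemma pos_elt_sa h : pos_elt h -> sa h.
Proof. by case=> s ss ->; rewrite (us_starM ax) ss. Qed.

Lemma pos_elt_sc t h : 0 <= t -> pos_elt h -> pos_elt (sc t * h).
Proof.
move=> t0 [s ss ->]; exists (sc (Num.sqrt t) * s); first exact: us_sa_sc.
by rewrite us_sc_mul -(expr2 (Num.sqrt t)) sqr_sqrtr.
Qed.

(** After scaling to [t = 1] and [h = s^2], write [1 - s^2] as the square of some [r] commuting with
    [s]; then [N r ^+ 2 <= N (r^2 + s^2) = N 1]. With the converse [pos_elt_of_norm], positivity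
    becomes a norm condition. *)
Lemma pos_elt_norm_sub h t : 0 < t -> pos_elt h -> N h <= t -> N (sc t - h) <= t.
Proof.
move=> t0 ph ht; have tn : t != 0 by rewrite gt_eqF.
have /(pos_elt_sc (ltW (_ : 0 < t^-1)))[|s ss hs] := ph; first by rewrite invr_gt0.
have s1 : N (s * s) <= 1.
  rewrite -hs; apply: le_trans (us_norm_sc _ _) _; first by rewrite invr_ge0 ltW.
  by rewrite ler_pdivrMl// mulr1.
have [y [ysa _ ycomm yE]] := sqrt_one_sub (us_sa_comm ss ss (erefl _)) s1.
have -> : sc t - h = sc t * (1 - s * s).
  by rewrite -hs mulrBr mulr1 us_scV.
apply: le_trans (us_norm_sc _ (ltW t0)) _; rewrite -[leRHS]mulr1 ler_pM2l//.
have rsa : sa (1 - y) by rewrite us_starB us_star1 ysa.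
have N1 : N ((1 - y) * (1 - y) + s * s) <= 1 by rewrite yE subrK us_norm1.
rewrite -yE us_norm_sq//; apply: le_trans N1; apply: us_sqr_norm_le => //.
apply/commr_sym/commrB; first exact: commr1.
by apply: ycomm; apply: commrM.
Qed.

Lemma pos_elt_sqrt_of_norm h t : sa h -> 0 < t -> N (sc t - h) <= t ->
  exists r, [/\ pos_elt r, r * r = h & forall z, GRing.comm z h -> GRing.comm z r].
Proof.
move=> hsa t0 ht; have tn : t != 0 by rewrite gt_eqF.
set g := sc t^-1 * (sc t - h).
have g1 : 1 - g = sc t^-1 * h.
  by rewrite /g mulrBr -rmorphM mulVf// rmorph1 opprB addrCA subrr addr0.
have gsa : sa g by rewrite us_sa_sc// us_starB (us_sc_star ax) hsa.
have gN : N g <= 1.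
  apply: le_trans (us_norm_sc _ _) _; first by rewrite invr_ge0 ltW.
  by rewrite ler_pdivrMl// mulr1.
have [y [ysa yN ycomm yE]] := sqrt_one_sub gsa gN.
(* A second root shows that [1 - y] is itself a square, so the root of [h] is positive and not
   merely self-adjoint. *)
have [w [wsa _ _ wE]] := sqrt_one_sub ysa yN.
exists (sc (Num.sqrt t) * (1 - y)); split.
- apply: pos_elt_sc; first exact: sqrtr_ge0.
  by exists (1 - w); rewrite ?wE// us_starB us_star1 wsa.
- by rewrite us_sc_mul yE -(expr2 (Num.sqrt t)) sqr_sqrtr ?(ltW t0)// g1 us_scV.
- move=> z zh; apply: commrM; first exact: us_sc_comm ax _ _.
  apply: commrB; first exact: commr1.
  apply: ycomm; apply: commrM; first exact: us_sc_comm ax _ _.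
  by apply: commrB => //; exact: us_sc_comm ax _ _.
Qed.

Lemma pos_elt_of_norm h t : sa h -> 0 < t -> N (sc t - h) <= t -> pos_elt h.
Proof.
move=> hsa t0 /(pos_elt_sqrt_of_norm hsa t0)[r [/pos_elt_sa rsa rr _]].
by exists r.
Qed.

Lemma pos_elt_sqrt h : pos_elt h ->
  exists r, [/\ pos_elt r, r * r = h & forall z, GRing.comm z h -> GRing.comm z r].
Proof.
move=> ph; have t0 : 0 < N h + 1 by have := norm_ax_ge0 nx h; lra.
apply: (pos_elt_sqrt_of_norm (pos_elt_sa ph) t0).
by apply: pos_elt_norm_sub => //; lra.
Qed.

(** The norm criterion is stable under sums: add the bounds for [t - h] and [t - k]. *)
Lemma pos_eltD h k : pos_elt h -> pos_elt k -> pos_elt (h + k).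
Proof.
move=> ph pk; set t := N h + N k + 1.
have h0 := norm_ax_ge0 nx h; have k0 := norm_ax_ge0 nx k.
have t0 : 0 < t by rewrite /t; lra.
apply: (@pos_elt_of_norm _ (t + t)); last 1 first.
- rewrite rmorphD opprD addrACA; apply: le_trans (norm_axD nx _ _) _.
  by apply: lerD; apply: pos_elt_norm_sub => //; rewrite /t; lra.
- by rewrite (us_starD ax) !pos_elt_sa.
- lra.
Qed.

Lemma pos_elt_sc_sub h t : sa h -> 0 < t -> N h <= t -> pos_elt (sc t - h).
Proof.
move=> hsa t0 ht; apply: (@pos_elt_of_norm _ t) => //.
  by rewrite us_starB (us_sc_star ax) hsa.
by rewrite opprB addrCA subrr addr0.
Qed.

(** For [t] slightly above [N (h + k)], the element [t - h = (t - (h + k)) + k] is positive. Its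
    root [b] commutes with a root [a] of [h], and [a^2 + b^2 = t] bounds [N a ^+ 2 = N h] by [t]. *)
Lemma pos_elt_norm_le h k : pos_elt h -> pos_elt k -> N h <= N (h + k).
Proof.
move=> ph pk; apply/ler_addgt0Pr => e e0; set t := N (h + k) + e.
have hk0 := norm_ax_ge0 nx (h + k).
have t0 : 0 < t by rewrite /t; lra.
have hksa : sa (h + k) by apply/pos_elt_sa/pos_eltD.
have /pos_elt_sqrt[b [/pos_elt_sa bsa bb bcomm]] : pos_elt (sc t - h).
  have -> : sc t - h = (sc t - (h + k)) + k by rewrite opprD addrA subrK.
  by apply: pos_eltD => //; apply: pos_elt_sc_sub => //; rewrite /t; lra.
case: ph => a asa ha; rewrite ha us_norm_sq//.
apply: le_trans (us_sc_norm ax (ltW t0)).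
have -> : sc t = a * a + b * b by rewrite bb ha addrCA subrr addr0.
apply: us_sqr_norm_le => //; apply: bcomm; apply: commrB; first exact: us_sc_comm ax _ _.
by rewrite ha; apply: commrM.
Qed.

(* Since [c c^* + c^* c] is always positive, negativity of [c^* c] makes [c c^*]
   positive; comparing [c^* (t - c c^* ) c] for [t = |c|^2] with its value
   [- (t k + k^2)], [k = - c^* c], contradicts [t k + k^2 >= 2 k^2]. *)
Lemma neg_star_mul_eq0 c : pos_elt (- (star c * c)) -> c = 0.
Proof.
set k := - (star c * c) => pk; apply: (norm_ax_eq0 nx); set K := N c ^+ 2.
have Nk : N k = K by rewrite (norm_axN nx) (us_cstar ax).
apply/eqP; rewrite -[_ == 0](sqrf_eq0 (N c)) -/K; apply: contraT => Kn0.
have K0 : 0 < K by rewrite lt_def Kn0 sqr_ge0.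
have pl : pos_elt (c * star c).
  (* Up to sign, [p] and [q] are twice the real and imaginary parts of [c]. *)
  set p := c + star c; set q := iU * (c - star c).
  have psa : sa p by rewrite (us_starD ax) (us_starK ax) addrC.
  have qsa : sa q.
    rewrite (us_starM ax) (us_i_star ax) us_starB (us_starK ax) mulrN -mulNr opprB.
    exact: us_i_comm ax _.
  have pq : p * p + q * q = (c * star c + star c * c) + (c * star c + star c * c).
    have -> : q * q = - (c * c - c * star c - (star c * c - star c * star c)).
      rewrite /q mulrA -(mulrA iU) (us_i_comm ax (c - star c)) mulrA (us_i_sqr ax).
      by rewrite mulN1r mulNr mulrBl !mulrBr.
    rewrite /p mulrDl !mulrDr !opprB.
    move: (c * c) (c * star c) (star c * c) (star c * star c) => x y z w.
    rewrite (addrC x y) (addrACA y x) (addrC (z - w)) (addrACA y (- x)) -opprD.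
    by rewrite [LHS]addrACA subrr addr0.
  have -> : c * star c = sc 2^-1 * (p * p + q * q) + k by rewrite pq us_half addrK.
  apply: pos_eltD => //; apply: pos_elt_sc; first by lra.
  by apply: pos_eltD; [exists p|exists q].
have Nl : N (sc K - c * star c) <= K.
  apply: pos_elt_norm_sub => //.
  by rewrite -{1}(us_starK ax c) (us_cstar ax) us_norm_star.
have up : N (sc K * k + k * k) <= K ^+ 2.
  have -> : sc K * k + k * k = - (star c * (sc K - c * star c) * c).
    rewrite mulrBr mulrBl /k mulrN mulNr mulrN opprK opprB addrC -!mulrA.
    by congr (_ - _); rewrite !mulrA (us_sc_comm ax K (star c)).
  rewrite (norm_axN nx); apply: le_trans (us_normM ax _ _) _.
  rewrite expr2 {2}/K expr2 mulrA (ler_wpM2r (norm_ax_ge0 nx _))//.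
  apply: le_trans (us_normM ax _ _) _; rewrite us_norm_star mulrC.
  by rewrite ler_wpM2r// (norm_ax_ge0 nx).
have pkk : pos_elt (k * k) by exists k => //; apply: pos_elt_sa.
(* The difference of the two elements is [(K - k) k], a product of commuting positive elements. *)
have low : N (k * k + k * k) <= N (sc K * k + k * k).
  have -> : sc K * k + k * k = (k * k + k * k) + (sc K - k) * k.
    by rewrite mulrBl addrC -addrA (addrCA (k * k)) addrN addr0.
  apply: pos_elt_norm_le; first exact: pos_eltD.
  have [r [/pos_elt_sa rsa rr rcomm]] : exists r, [/\ pos_elt r, r * r = sc K - k
      & forall z, GRing.comm z (sc K - k) -> GRing.comm z r].
    by apply/pos_elt_sqrt/pos_elt_sc_sub; rewrite ?Nk//; apply: pos_elt_sa.
  have [s ssa ks] := pk.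
  have rs : GRing.comm r s.
    apply/commr_sym/rcomm; apply: commrB; first exact: us_sc_comm ax _ _.
    by rewrite ks; apply: commrM.
  exists (r * s); first exact: us_sa_comm.
  by rewrite -rr ks -!mulrA (mulrA s r) -rs -!mulrA.
(* The bounds combine to [K^2 = N (k^2) <= K^2 / 2], which is impossible for [K > 0]. *)
have : N (k * k) <= 2^-1 * N (k * k + k * k).
  by rewrite -{1}(us_half (k * k)); apply: us_norm_sc; lra.
rewrite us_norm_sq; last exact: pos_elt_sa.
rewrite Nk; have : 0 < K ^+ 2 by rewrite exprn_gt0.
by lra.
Qed.

(** Let [m] be the root of [h^2] and [n] the root of [m]; [q = m - h] is twice the negative part of
    [h], so [h q = - m q]. Then [- star (u q) (u q) = (n q)^2] is positive, which forces [u q = 0],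
    then [n q = 0], [m q = 0] and [q^2 = 0]. Hence [h = m]. *)
Lemma pos_elt_star_mul u : pos_elt (star u * u).
Proof.
set h := star u * u.
have hsa : sa h by rewrite (us_starM ax) (us_starK ax).
have /pos_elt_sqrt[m [pm mm mcomm]] : pos_elt (h * h) by exists h.
have msa := pos_elt_sa pm.
have [n [pn nn ncomm]] := pos_elt_sqrt pm.
have nsa := pos_elt_sa pn.
have hm : GRing.comm h m by apply: mcomm; apply: commrM.
have hn : GRing.comm h n by exact: ncomm.
have mn : GRing.comm m n by exact: ncomm.
set q := m - h.
have qsa : sa q by rewrite us_starB msa hsa.
have hq : h * q = - (m * q).
  by rewrite /q !mulrBr opprB mm hm.
have nq : GRing.comm n q by apply: commrB; apply: commr_sym.
have cc : - (star (u * q) * (u * q)) = (n * q) * (n * q).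
  rewrite (us_starM ax) qsa -mulrA (mulrA (star u)) -/h hq mulrN opprK.
  by rewrite -nn !mulrA -nq -!mulrA (mulrA q n) -nq -!mulrA.
have nqsa : sa (n * q) by exact: us_sa_comm.
have uq0 : u * q = 0 by apply: neg_star_mul_eq0; rewrite cc; exists (n * q).
have nq0 : n * q = 0.
  apply: (norm_ax_eq0 nx); apply/eqP; rewrite -sqrf_eq0 -us_norm_sq// -cc uq0.
  by rewrite mulr0 oppr0 (norm_ax0 nx).
have mq0 : m * q = 0 by rewrite -nn -mulrA nq0 mulr0.
have q0 : q = 0.
  apply: (norm_ax_eq0 nx); apply/eqP; rewrite -sqrf_eq0 -us_norm_sq//.
  by rewrite {1}/q mulrBl hq mq0 oppr0 subr0 (norm_ax0 nx).
by rewrite -(subr0_eq q0).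
Qed.

Lemma us_norm_star_mul_le u v : N u ^+ 2 <= N (star u * u + star v * v).
Proof.
by rewrite -(us_cstar ax); apply: pos_elt_norm_le; apply: pos_elt_star_mul.
Qed.

End UnitalCstar.

(** * The multiplier algebra *)

Section CstarBasics.
Local Open Scope complex_scope.
Variable R : realType.

Definition cabs (k : R[i]) : R := complex.Re `|k|.

Lemma cabsE k : `|k| = (cabs k)%:C.
Proof. by rewrite /cabs normc_def. Qed.

Lemma cabs_ge0 k : 0 <= cabs k.
Proof. by rewrite -ler0c -cabsE. Qed.

Lemma cabs_real (t : R) : 0 <= t -> cabs t%:C = t.
Proof. by move=> t0; rewrite /cabs ger0_norm ?ler0c. Qed.

Lemma cabsN1 : cabs (-1) = 1.
Proof. by rewrite /cabs normrN1. Qed.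

Variable A : cstar_algebra R.
Implicit Types a b c d : A.
Let ax := cs_ax A.
Local Notation "a ** b" := (cs_mul a b) (at level 40, left associativity).
Local Notation star := (@cs_star R A).
Local Notation nrm := (@cs_norm R A).

Lemma cs_normZr k a : nrm (k *: a) = cabs k * nrm a.
Proof. by apply: complexI; rewrite (cs_normZ ax) cabsE rmorphM. Qed.

Lemma cs_normN a : nrm (- a) = nrm a.
Proof. by rewrite -scaleN1r cs_normZr cabsN1 mul1r. Qed.

Lemma cs_norm_axioms : norm_axioms nrm.
Proof.
split; [exact: cs_norm_ge0 ax| |exact: cs_norm_eq0 ax|exact: cs_normN
  |exact: cs_normD ax].
by rewrite -(scale0r (0 : A)) cs_normZr /cabs normr0 mul0r.
Qed.
Let nx := cs_norm_axioms.

Lemma cs_mul0l a : 0 ** a = 0.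
Proof. by rewrite -(scale0r (0 : A)) (cs_mulZl ax) !scale0r. Qed.

Lemma cs_mul0r a : a ** 0 = 0.
Proof. by rewrite -(scale0r (0 : A)) (cs_mulZr ax) !scale0r. Qed.

Lemma cs_mulNl a b : (- a) ** b = - (a ** b).
Proof. by apply/eqP; rewrite -addr_eq0 -(cs_mulDl ax) addNr cs_mul0l. Qed.

Lemma cs_mulNr a b : a ** (- b) = - (a ** b).
Proof. by apply/eqP; rewrite -addr_eq0 -(cs_mulDr ax) addNr cs_mul0r. Qed.

Lemma cs_mulBl a b c : (a - b) ** c = a ** c - b ** c.
Proof. by rewrite (cs_mulDl ax) cs_mulNl. Qed.

Lemma cs_star0 : star (0 : A) = 0.
Proof. by rewrite -(scale0r (0 : A)) (cs_starZ ax) conjc0 !scale0r. Qed.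

Lemma cs_starN a : star (- a) = - star a.
Proof. by apply/eqP; rewrite -addr_eq0 -(cs_starD ax) addNr cs_star0. Qed.

Lemma cs_starB a b : star (a - b) = star a - star b.
Proof. by rewrite (cs_starD ax) cs_starN. Qed.

Lemma cs_norm_star a : nrm (star a) = nrm a.
Proof.
suff le_star b : nrm b <= nrm (star b).
  by apply/le_anti; rewrite le_star -{2}(cs_starK ax a) le_star.
have := norm_ax_ge0 nx b; rewrite le_eqVlt => /orP[/eqP<-|b0].
  exact: norm_ax_ge0 nx _.
by rewrite -(ler_pM2r b0) -expr2 -(cs_cstar ax) (cs_normM ax).
Qed.

(** The choice [c = d - e] and the C*-identity give the claim. Identities between values of
    multipliers are tested in this way, through the adjoint relation. *)
Lemma cs_star_mul_inj d e : (forall c, star d ** c = star e ** c) -> d = e.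
Proof.
move=> de; apply/subr0_eq/(norm_ax_eq0 nx)/eqP; rewrite -sqrf_eq0 -(cs_cstar ax).
by rewrite cs_starB cs_mulBl de subrr (norm_ax0 nx).
Qed.

End CstarBasics.

(* Adjointable bounded operators on [A], viewed as a Hilbert module over itself:
   a unital algebra containing [A] isometrically, whether or not [A] has a unit. *)
Record multiplier (R : realType) (A : cstar_algebra R) := Multiplier {
  mfun :> A -> A;
  madj : A -> A;
  madjE : forall b c : A,
    cs_mul (cs_star (mfun b)) c = cs_mul (cs_star b) (madj c);
  mbounded : exists M : R, forall b : A, cs_norm (mfun b) <= M * cs_norm b }.

Section Multiplier.
Local Open Scope complex_scope.
Variables (R : realType) (A : cstar_algebra R).
Let ax := cs_ax A.
Let nx := cs_norm_axioms A.
Local Notation "a ** b" := (cs_mul a b) (at level 40, left associativity).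
Local Notation star := (@cs_star R A).
Local Notation nrm := (@cs_norm R A).
Implicit Types (T S : multiplier A) (a b c : A).

Lemma madjEl T b c : star (madj T b) ** c = star b ** T c.
Proof.
by apply: (can_inj (cs_starK ax)); rewrite !(cs_starM ax) !(cs_starK ax) -madjE.
Qed.

(** The operator determines its adjoint, and the remaining fields are propositions. *)
Lemma mult_ext T S : (forall b, T b = S b) -> T = S.
Proof.
move=> TS; have adj c : madj T c = madj S c.
  by apply: cs_star_mul_inj => d; rewrite !madjEl TS.
case: T S TS adj => [f f' fE fB] [g g' gE gB] /= /funext fg /funext fg'.
by subst; congr Multiplier; apply: Prop_irrelevance.
Qed.

(** Pairing with an arbitrary [d] moves the operator onto [d] as its adjoint, where additivity is
    that of the product. *)
Lemma multD T b c : T (b + c) = T b + T c.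
Proof.
apply: cs_star_mul_inj => d.
by rewrite (cs_starD ax) (cs_mulDl ax) !madjE (cs_starD ax) (cs_mulDl ax).
Qed.

Lemma multZ T (k : R[i]) b : T (k *: b) = k *: T b.
Proof.
apply: cs_star_mul_inj => d.
by rewrite madjE !(cs_starZ ax) !(cs_mulZl ax) madjE.
Qed.

Definition mult_const (k : R[i]) : multiplier A.
Proof.
refine (@Multiplier _ _ (fun b => k *: b) (fun b => conjc k *: b) _ _).
  by move=> b c; rewrite (cs_starZ ax) (cs_mulZl ax) (cs_mulZr ax).
by exists (cabs k) => b; rewrite cs_normZr.
Defined.

Definition mult_add T S : multiplier A.
Proof.
refine (@Multiplier _ _ (fun b => T b + S b) (fun b => madj T b + madj S b) _ _).
  by move=> b c; rewrite (cs_starD ax) (cs_mulDl ax) (cs_mulDr ax) !madjE.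
have [M TM] := mbounded T; have [M' SM] := mbounded S.
exists (M + M') => b; rewrite mulrDl.
exact: le_trans (cs_normD ax _ _) (lerD (TM _) (SM _)).
Defined.

Definition mult_comp T S : multiplier A.
Proof.
refine (@Multiplier _ _ (fun b => T (S b)) (fun b => madj S (madj T b)) _ _).
  by move=> b c; rewrite !madjE.
have [M TM] := mbounded T; have [M' SM] := mbounded S.
exists (`|M| * M') => b; apply: le_trans (TM _) _; rewrite -mulrA.
apply: le_trans (ler_wpM2l (normr_ge0 _) (SM b)).
by rewrite ler_wpM2r ?(cs_norm_ge0 ax)// ler_norm.
Defined.

(** With [d = madj T b], the C*-identity gives [|d|^2 = |star b (T d)| <= |b| M |d|]; cancel
    [|d|]. *)
Lemma madj_le T M : 0 <= M -> (forall b, nrm (T b) <= M * nrm b) ->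
  forall b, nrm (madj T b) <= M * nrm b.
Proof.
move=> M0 TM b.
have := norm_ax_ge0 nx (madj T b); rewrite le_eqVlt => /orP[/eqP<-|b0].
  by rewrite mulr_ge0// (norm_ax_ge0 nx).
rewrite -(ler_pM2r b0) -expr2 -(cs_cstar ax) madjEl.
apply: le_trans (cs_normM ax _ _) _; rewrite cs_norm_star [M * _]mulrC -mulrA.
by rewrite ler_wpM2l ?(norm_ax_ge0 nx).
Qed.

Definition mult_star T : multiplier A.
Proof.
refine (@Multiplier _ _ (madj T) T (madjEl T) _).
have [M TM] := mbounded T; exists `|M|; apply: madj_le => // b.
by apply: le_trans (TM b) _; rewrite ler_wpM2r ?(norm_ax_ge0 nx)// ler_norm.
Defined.

Definition mult_left (a : A) : multiplier A.
Proof.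
refine (@Multiplier _ _ (cs_mul a) (cs_mul (star a)) _ _).
  by move=> b c; rewrite (cs_starM ax) (cs_mulA ax).
by exists (nrm a) => b; exact: cs_normM ax _ _.
Defined.

(** * Ring structure on multipliers *)

HB.instance Definition _ := gen_eqMixin (multiplier A).
HB.instance Definition _ := gen_choiceMixin (multiplier A).

Fact mult_addA : associative mult_add.
Proof. by move=> T S V; apply: mult_ext => b /=; rewrite addrA. Qed.
Fact mult_addC : commutative mult_add.
Proof. by move=> T S; apply: mult_ext => b /=; rewrite addrC. Qed.
Fact mult_add0 : left_id (mult_const 0) mult_add.
Proof. by move=> T; apply: mult_ext => b /=; rewrite scale0r add0r. Qed.
Fact mult_addN : left_inverse (mult_const 0) (mult_comp (mult_const (-1))) mult_add.
Proof. by move=> T; apply: mult_ext => b /=; rewrite scale0r scaleN1r addNr. Qed.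
HB.instance Definition _ :=
  GRing.isZmodule.Build (multiplier A) mult_addA mult_addC mult_add0 mult_addN.

Fact mult_compA : associative mult_comp.
Proof. by move=> T S V; apply: mult_ext. Qed.
Fact mult_comp1 : left_id (mult_const 1) mult_comp.
Proof. by move=> T; apply: mult_ext => b /=; rewrite scale1r. Qed.
Fact mult_comp1r : right_id (mult_const 1) mult_comp.
Proof. by move=> T; apply: mult_ext => b /=; rewrite scale1r. Qed.
Fact mult_compDl : left_distributive mult_comp mult_add.
Proof. by move=> T S V; apply: mult_ext. Qed.
Fact mult_compDr : right_distributive mult_comp mult_add.
Proof. by move=> T S V; apply: mult_ext => b /=; rewrite multD. Qed.
HB.instance Definition _ := GRing.Zmodule_isPzRing.Build (multiplier A)
  mult_compA mult_comp1 mult_comp1r mult_compDl mult_compDr.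

Definition mult_sc (t : R) : multiplier A := mult_const t%:C.

Fact mult_sc_additive : additive mult_sc.
Proof.
move=> s t; apply: mult_ext => b /=.
by rewrite rmorphB scalerBl scaleN1r.
Qed.
Fact mult_sc_multiplicative : multiplicative mult_sc.
Proof.
split=> [s t|]; apply: mult_ext => b //=.
by rewrite rmorphM scalerA.
Qed.
HB.instance Definition _ := GRing.isAdditive.Build R (multiplier A) mult_sc
  mult_sc_additive.
HB.instance Definition _ := GRing.isMultiplicative.Build R (multiplier A) mult_sc
  mult_sc_multiplicative.


(** * The operator norm as the least bound, and its completeness *)

Definition mult_bounds T : set R :=
  [set M : R | 0 <= M /\ forall b, nrm (T b) <= M * nrm b]%classic.

Definition mult_norm T : R := inf (mult_bounds T).

Lemma mult_bounds_inf T : has_inf (mult_bounds T).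
Proof.
split; last by exists 0 => M [].
have [M TM] := mbounded T; exists `|M|; split=> // b.
by apply: le_trans (TM b) _; rewrite ler_wpM2r ?(norm_ax_ge0 nx)// ler_norm.
Qed.

Lemma mult_norm_le T M : 0 <= M -> (forall b, nrm (T b) <= M * nrm b) ->
  mult_norm T <= M.
Proof. by move=> M0 TM; apply: ge_inf; [case: (mult_bounds_inf T)|split]. Qed.

Lemma mult_norm_ge0 T : 0 <= mult_norm T.
Proof. by apply: lb_le_inf => [|M []//]; case: (mult_bounds_inf T). Qed.

(** For [|b| > 0] the quotient [|T b| / |b|] is a lower bound of all admissible constants, so the
    infimum is admissible too. *)
Lemma mult_normP T b : nrm (T b) <= mult_norm T * nrm b.
Proof.
have := norm_ax_ge0 nx b; rewrite le_eqVlt => /orP[/eqP b0|b0].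
  have [M /(_ b)] := mbounded T.
  by rewrite -b0 !mulr0.
rewrite -ler_pdivrMr//; apply: lb_le_inf; first by case: (mult_bounds_inf T).
by move=> M [_ TM]; rewrite ler_pdivrMr.
Qed.

Lemma mult_norm_adj T : mult_norm (mult_star T) <= mult_norm T.
Proof.
by apply/mult_norm_le/madj_le; [|exact: mult_norm_ge0|exact: mult_normP];
  exact: mult_norm_ge0.
Qed.

Lemma multB T S b : (T - S) b = T b - S b.
Proof. by rewrite -[in RHS]scaleN1r. Qed.

Lemma mult_norm_axioms : norm_axioms mult_norm.
Proof.
have NN T : mult_norm (- T) <= mult_norm T.
  apply: mult_norm_le (mult_norm_ge0 T) _ => b /=.
  by rewrite scaleN1r (norm_axN nx) mult_normP.
split.
- exact: mult_norm_ge0.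
- apply/le_anti; rewrite mult_norm_ge0 andbT; apply: mult_norm_le => // b.
  by rewrite /= scale0r (norm_ax0 nx) mul0r.
- move=> T T0; apply: mult_ext => b /=; rewrite scale0r; apply: (norm_ax_eq0 nx).
  by apply/le_anti; rewrite (norm_ax_ge0 nx) andbT -[leRHS](mul0r (nrm b)) -T0 mult_normP.
- by move=> T; apply/le_anti; rewrite NN -{1}[T]opprK NN.
- move=> T S; apply: mult_norm_le; first by rewrite addr_ge0 ?mult_norm_ge0.
  move=> b; rewrite mulrDl; apply: le_trans (norm_axD nx _ _) (lerD _ _);
  exact: mult_normP.
Qed.

Lemma mult_starB T S : mult_star (T - S) = mult_star T - mult_star S.
Proof.
apply: mult_ext => b; rewrite multB; apply: cs_star_mul_inj => c.
by rewrite madjEl multB cs_starB cs_mulBl !madjEl (cs_mulDr ax) cs_mulNr.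
Qed.

Lemma mult_cauchy_pt u b : norm_cauchy mult_norm u ->
  exists l, tends_to nrm (fun n => u n b) l.
Proof.
move=> cu; have [e e0|l ul] := cs_complete ax (u := fun n => u n b); last by exists l.
have b1 : 0 < nrm b + 1 by have := norm_ax_ge0 nx b; lra.
have [N uN] := cu _ (divr_gt0 e0 b1); exists N => m n Nm Nn.
have := uN m n Nm Nn; rewrite ltr_pdivlMr//; apply: le_lt_trans.
rewrite -multB; apply: le_trans (mult_normP _ _) _.
by rewrite ler_wpM2l ?mult_norm_ge0// lerDl.
Qed.

(** The operators and their adjoints converge pointwise, the adjoint relation passes to the limits,
    and the Cauchy condition makes the convergence uniform. *)
Lemma mult_complete : norm_complete mult_norm.
Proof.
move=> u cu.
have pt b : exists l, tends_to nrm (fun n => u n b) l by exact: mult_cauchy_pt.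
have ptadj b : exists l, tends_to nrm (fun n => madj (u n) b) l.
  apply: (@mult_cauchy_pt (fun n => mult_star (u n))) => e /cu[N uN].
  exists N => m n Nm Nn; rewrite -mult_starB.
  exact: le_lt_trans (mult_norm_adj _) (uN _ _ Nm Nn).
have [f fl] := choice pt; have [g gl] := choice ptadj.
have close (e : R) : 0 < e -> exists N : nat, forall n, (N <= n)%N ->
    forall b, nrm (f b - u n b) <= e * nrm b.
  move=> e0; have [N uN] := cu _ e0; exists N => n Nn b.
  (* Shifting the index by [N] makes the Cauchy bound hold at every term, as [tends_to_le]
     requires. *)
  apply: (tends_to_le nx _ (tends_to_subseq (fun k => leq_addr N k) (fl b))) => k.
  rewrite -multB; apply: le_trans (mult_normP _ _) _.
  by rewrite ler_wpM2r ?(norm_ax_ge0 nx)// ltW// uN// leq_addl.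
have fg b c : star (f b) ** c = star b ** g c.
  apply: (tends_to_unique nx (u := fun n => star (u n b) ** c)).
    have := null_seqM (norm_ax_ge0 nx c) (fl b); apply: null_seq_le => n.
    rewrite -cs_mulBl -cs_starB mulrC -[X in _ <= X * _]cs_norm_star.
    exact: cs_normM ax _ _.
  have := null_seqM (norm_ax_ge0 nx b) (gl c); apply: null_seq_le => n.
  rewrite madjE -cs_mulNr -(cs_mulDr ax) -(cs_norm_star b).
  exact: cs_normM ax _ _.
have fB : exists M : R, forall b, nrm (f b) <= M * nrm b.
  have [N /(_ _ (leqnn N)) fN] := close 1 ltr01; exists (1 + mult_norm (u N)) => b.
  rewrite mulrDl -{1}(subrK (u N b) (f b)); apply: le_trans (norm_axD nx _ _) _.
  by apply: lerD => //; exact: mult_normP.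
exists (Multiplier fg fB) => e e0; have e2 : 0 < e / 2 by lra.
have [N fN] := close _ e2; exists N => n Nn.
apply: (@le_lt_trans _ _ (e / 2)); last by lra.
apply: mult_norm_le; first exact: ltW.
by move=> b; rewrite multB (norm_axC nx); exact: fN.
Qed.

(** The lower bound is obtained by evaluating at [star a], where the product has norm [|a|^2]. *)
Lemma mult_left_norm a : mult_norm (mult_left a) = nrm a.
Proof.
apply/le_anti/andP; split.
  by apply: mult_norm_le => [|b]; [exact: norm_ax_ge0 nx _|exact: cs_normM ax _ _].
have := norm_ax_ge0 nx a; rewrite [0 <= _]le_eqVlt => /orP[/eqP<-|a0].
  exact: mult_norm_ge0.
rewrite -(ler_pM2r a0) -[X in _ * X <= _](cs_norm_star a).
rewrite -[X in _ <= _ * X](cs_norm_star a).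
rewrite cs_norm_star -expr2 -cs_norm_star -(cs_cstar ax) (cs_starK ax).
exact: (mult_normP (mult_left a)).
Qed.

Lemma mult_unital_cstar :
  unital_cstar mult_sc (mult_const 'i) mult_star mult_norm.
Proof.
have NM T S : mult_norm (T * S) <= mult_norm T * mult_norm S.
  apply: mult_norm_le => [|b]; first by rewrite mulr_ge0 ?mult_norm_ge0.
  apply: le_trans (mult_normP T (S b)) _; rewrite -mulrA.
  by rewrite ler_wpM2l ?mult_norm_ge0// mult_normP.
split.
- exact: mult_norm_axioms.
- exact: mult_complete.
- exact: NM.
- move=> T; apply/le_anti/andP; split.
    apply: le_trans (NM _ _) _; rewrite expr2 ler_wpM2r ?mult_norm_ge0//.
    exact: mult_norm_adj.
  (* The root of the norm of [mult_star T * T] is a bound for [T], because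
     [|T b|^2 = |star b (mult_star T (T b))|]. *)
  rewrite -[leRHS]sqr_sqrtr ?mult_norm_ge0// lerXn2r ?nnegrE ?mult_norm_ge0 ?sqrtr_ge0//.
  apply: mult_norm_le => [|b]; first exact: sqrtr_ge0.
  rewrite -(@ler_pXn2r _ 2) ?nnegrE ?mulr_ge0 ?sqrtr_ge0 ?(norm_ax_ge0 nx)//.
  rewrite exprMn sqr_sqrtr ?mult_norm_ge0// -(cs_cstar ax) madjE.
  apply: le_trans (cs_normM ax _ _) _; rewrite cs_norm_star expr2 mulrCA.
  rewrite ler_wpM2l ?(norm_ax_ge0 nx)//.
  exact: (mult_normP (mult_star T * T)).
- by move=> T; apply: mult_ext.
- by move=> T S; apply: mult_ext.
- by move=> T S; apply: mult_ext.
- by move=> t T; apply: mult_ext => b /=; rewrite multZ.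
- by move=> t; apply: mult_ext => b; congr (_ *: _); exact: conjc_real.
- move=> t t0; apply: mult_norm_le => // b /=.
  by rewrite cs_normZr cabs_real.
- by move=> T; apply: mult_ext => b /=; rewrite multZ.
- apply: mult_ext => b /=; rewrite scalerA mulN1r; congr (_ *: _).
  by apply/eqP; rewrite eq_complex /= oppr0 !eqxx.
- apply: mult_ext => b /=; rewrite scalerA scale1r -expr2 sqr_i.
  by [].
Qed.

(** Left multiplication embeds the algebra isometrically, compatibly with products, sums and
    adjoints, so the unital inequality pulls back. *)
Theorem cs_norm_star_mul_le a b :
  nrm a ^+ 2 <= nrm (star a ** a + star b ** b).
Proof.
have := us_norm_star_mul_le mult_unital_cstar (mult_left a) (mult_left b).
suff -> : mult_star (mult_left a) * mult_left a + mult_star (mult_left b) * mult_left b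
    = mult_left (star a ** a + star b ** b) by rewrite !mult_left_norm.
by apply: mult_ext => c /=; rewrite (cs_mulDl ax) !(cs_mulA ax).
Qed.

End Multiplier.

(** * Norm of a Hilbert module *)

Section HilbertModule.
Local Open Scope complex_scope.
Variables (R : realType) (A : cstar_algebra R) (X : hilmod A).
Let ax := cs_ax A.
Let anx := cs_norm_axioms A.
Let hx := hm_ax X.
Local Notation "a ** b" := (cs_mul a b) (at level 40, left associativity).
Local Notation star := (@cs_star R A).
Local Notation nrm := (@cs_norm R A).
Local Notation ip := (@hm_ip R A X).
Local Notation act := (@hm_act R A X).
Local Notation hnrm := (@hm_norm R A X).
Implicit Types (x y z : X) (a b : A).

Lemma hm_ipDr x y z : ip x (y + z) = ip x y + ip x z.
Proof. by rewrite -!(hm_ipC hx _ x) (hm_ipDl hx) (cs_starD ax). Qed.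

Lemma hm_ipZr k x y : ip x (k *: y) = conjc k *: ip x y.
Proof. by rewrite -!(hm_ipC hx _ x) (hm_ipZl hx) (cs_starZ ax). Qed.

Lemma hm_ip0r x : ip x 0 = 0.
Proof. by rewrite -(scale0r (0 : X)) hm_ipZr conjc0 scale0r. Qed.

Lemma hm_ipNl x y : ip (- x) y = - ip x y.
Proof. by rewrite -(scaleN1r x) (hm_ipZl hx) scaleN1r. Qed.

Lemma hm_ipNr x y : ip x (- y) = - ip x y.
Proof. by rewrite -!(hm_ipC hx _ x) hm_ipNl cs_starN. Qed.

(** The second slot is conjugate linear, hence the restriction to real [k]. The degree 3 is the
    source of the factor 8 in the contraction condition. *)
Lemma hm_tripleZ (k : R[i]) x y z : conjc k = k ->
  act (ip (k *: x) (k *: y)) (k *: z) = k ^+ 3 *: act (ip x y) z.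
Proof.
move=> kk; rewrite (hm_ipZl hx) hm_ipZr kk -(hm_actZr hx) -!(hm_actZl hx) !scalerA.
by rewrite -expr2 -exprSr.
Qed.

Lemma hm_norm_ge0 x : 0 <= hnrm x.
Proof. exact: sqrtr_ge0. Qed.

Lemma hm_sqr_norm x : hnrm x ^+ 2 = nrm (ip x x).
Proof. by rewrite sqr_sqrtr ?(norm_ax_ge0 anx). Qed.

(* Expand the positive element [<t a x - y, t a x - y>] with [a = <y, x>] and
   [t = 1 / |<x, x>|]. *)
Lemma hm_cauchy_schwarz x y : nrm (ip x y) <= hnrm x * hnrm y.
Proof.
have [x0|x0] := eqVneq (nrm (ip x x)) 0.
  have /(hm_ip_eq0 hx) -> := norm_ax_eq0 anx x0.
  rewrite -(hm_ipC hx) hm_ip0r cs_star0 (norm_ax0 anx).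
  by rewrite mulr_ge0 ?hm_norm_ge0.
have P0 : 0 < nrm (ip x x) by rewrite lt_def x0 (norm_ax_ge0 anx).
rewrite -(@ler_pXn2r _ 2) ?nnegrE ?mulr_ge0 ?hm_norm_ge0 ?(norm_ax_ge0 anx)//.
rewrite exprMn !hm_sqr_norm -(cs_norm_star (ip x y)) (hm_ipC hx).
set a := ip y x; set P := nrm (ip x x) in P0 *; set t := P^-1.
have t0 : 0 < t by rewrite invr_gt0.
set z := act (t%:C *: a) x - y.
(* Scaled so that [star w ** w] equals the cross terms [2 t a (star a)]; adding it to [ip z z]
   cancels them and leaves sums of positive elements. *)
set w := (Num.sqrt (2 * t))%:C *: star a.
have [c zc] := hm_ip_pos hx z.
have wE : star w ** w = t%:C *: (a ** star a) + t%:C *: (a ** star a).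
  rewrite /w (cs_starZ ax) conjc_real (cs_starK ax) (cs_mulZl ax) (cs_mulZr ax).
  rewrite scalerA -rmorphM -expr2 sqr_sqrtr ?mulr_ge0 ?(ltW t0)//.
  by rewrite mulr_natl mulr2n rmorphD scalerDl.
have zE : ip z z + star w ** w = ip y y + (t ^+ 2)%:C *: (a ** ip x x ** star a).
  rewrite {}wE /z (hm_ipDl hx) !hm_ipDr !hm_ipNl !hm_ipNr opprK !(hm_ipA hx).
  rewrite -(hm_ipC hx (act _ _) y) -(hm_ipC hx (act _ _) x) !(hm_ipA hx).
  rewrite !(cs_starM ax) !(cs_mulZl ax) !(cs_starZ ax) !conjc_real !(cs_mulZr ax).
  rewrite !(hm_ipC hx) -/a (cs_mulA ax) scalerA -rmorphM -expr2.
  by rewrite (addrA (_ - _)) -[X in X + ip y y]addrA -opprD addrAC subrK addrC.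
have low := cs_norm_star_mul_le w c.
rewrite -zc addrC zE in low.
have up : nrm (ip y y + (t ^+ 2)%:C *: (a ** ip x x ** star a)) <=
    nrm (ip y y) + t ^+ 2 * (nrm a ^+ 2 * P).
  apply: le_trans (norm_axD anx _ _) _; rewrite lerD2l cs_normZr.
  rewrite cabs_real ?sqr_ge0// ler_wpM2l ?sqr_ge0//.
  apply: le_trans (cs_normM ax _ _) _; rewrite cs_norm_star expr2 mulrAC.
  by rewrite ler_wpM2r ?(norm_ax_ge0 anx)// (cs_normM ax).
have := le_trans low up.
rewrite cs_normZr cabs_real ?sqrtr_ge0// exprMn sqr_sqrtr ?mulr_ge0 ?(ltW t0)//.
(* Multiplying by [P = t^-1] turns the estimate into [2 |a|^2 <= P |ip y y| + |a|^2]. *)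
rewrite cs_norm_star => /(ler_wpM2l (ltW P0)).
have -> : P * (2 * t * nrm a ^+ 2) = 2 * nrm a ^+ 2 by rewrite /t; field.
have -> : P * (nrm (ip y y) + t ^+ 2 * (nrm a ^+ 2 * P)) = P * nrm (ip y y) + nrm a ^+ 2.
  by rewrite /t; field.
lra.
Qed.

Lemma hm_normZ k x : hnrm (k *: x) = cabs k * hnrm x.
Proof.
apply/eqP; rewrite -(@eqrXn2 _ 2) ?mulr_ge0 ?cabs_ge0 ?hm_norm_ge0//.
rewrite exprMn !hm_sqr_norm (hm_ipZl hx) hm_ipZr !cs_normZr mulrA.
by rewrite expr2 {2}/cabs normcJ.
Qed.

Lemma hm_norm_axioms : norm_axioms hnrm.
Proof.
split.
- exact: hm_norm_ge0.
- by rewrite -(scale0r (0 : X)) hm_normZ /cabs normr0 mul0r.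
- move=> x x0; apply/(hm_ip_eq0 hx)/(norm_ax_eq0 anx).
  by rewrite -hm_sqr_norm x0 expr0n.
- by move=> x; rewrite -scaleN1r hm_normZ cabsN1 mul1r.
- move=> x y; rewrite -(@ler_pXn2r _ 2) ?nnegrE ?addr_ge0 ?hm_norm_ge0//.
  rewrite hm_sqr_norm (hm_ipDl hx) !hm_ipDr.
  apply: le_trans (norm_axD anx _ _) _.
  have := norm_axD anx (ip x x) (ip x y); have := norm_axD anx (ip y x) (ip y y).
  have := hm_cauchy_schwarz x y; have := hm_cauchy_schwarz y x.
  by rewrite -!hm_sqr_norm sqrrD; lra.
Qed.

Lemma hm_norm_act a x : hnrm (act a x) <= nrm a * hnrm x.
Proof.
rewrite -(@ler_pXn2r _ 2) ?nnegrE ?mulr_ge0 ?hm_norm_ge0 ?(norm_ax_ge0 anx)//.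
rewrite exprMn !hm_sqr_norm (hm_ipA hx) -(hm_ipC hx (act _ _) x) (hm_ipA hx).
rewrite (cs_starM ax) (hm_ipC hx); apply: le_trans (cs_normM ax _ _) _.
rewrite expr2 -mulrA ler_wpM2l ?(norm_ax_ge0 anx)// mulrC.
by apply: le_trans (cs_normM ax _ _) _; rewrite cs_norm_star.
Qed.

Lemma hm_tends_to_triple u v w x y z :
  tends_to hnrm u x -> tends_to hnrm v y -> tends_to hnrm w z ->
  tends_to hnrm (fun n => act (ip (u n) (v n)) (w n)) (act (ip x y) z).
Proof.
move=> ux vy; apply: (tends_to_biadditive anx hm_norm_axioms hm_norm_axioms
  (hm_actDl hx) (hm_actDr hx) hm_norm_act).
exact: (tends_to_biadditive hm_norm_axioms hm_norm_axioms anx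
  (hm_ipDl hx) hm_ipDr hm_cauchy_schwarz).
Qed.

Lemma hm_norm_complete : norm_complete hnrm.
Proof. exact: hm_complete hx. Qed.

End HilbertModule.

(** * Additive maps compatible with unimodular scalars *)

Section UnimodularLinear.
Local Open Scope complex_scope.
Variables (R : realType) (V W : lmodType R[i]) (H : V -> W).
Hypothesis H_unimod : forall (mu : R[i]) x y, `|mu| = 1 ->
  H (mu *: x + y) = mu *: H x + H y.

Lemma unimodularD x y : H (x + y) = H x + H y.
Proof. by have := H_unimod x y (normr1 _); rewrite !scale1r. Qed.

Lemma unimodular0 : H 0 = 0.
Proof. by apply: (addrI (H 0)); rewrite -unimodularD !addr0. Qed.

Lemma unimodularU (mu : R[i]) x : `|mu| = 1 -> H (mu *: x) = mu *: H x.
Proof. by move=> mu1; have := H_unimod x 0 mu1; rewrite unimodular0 !addr0. Qed.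

Lemma unimodular_nat n x : H (n%:R *: x) = n%:R *: H x.
Proof.
elim: n => [|n IH]; first by rewrite !scale0r unimodular0.
by rewrite -natr1 !scalerDl unimodularD IH !scale1r.
Qed.

(* A real [t] in [0, 2] is a sum of two conjugate unimodular numbers. *)
Lemma unimodular_real (t : R) x : 0 <= t -> t <= 2 -> H (t%:C *: x) = t%:C *: H x.
Proof.
move=> t0 t2; set s := Num.sqrt (1 - (t / 2) ^+ 2).
have s2 : s ^+ 2 = 1 - (t / 2) ^+ 2 by rewrite sqr_sqrtr//; nra.
have nmu (e : R) : e ^+ 2 = s ^+ 2 -> `|(t / 2 +i* e)| = 1 :> R[i].
  by move=> es; rewrite normc_def /= es s2 addrCA subrr addr0 sqrtr1.
have -> : t%:C = (t / 2 +i* s) + (t / 2 -i* s).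
  by apply/eqP; rewrite eq_complex /= subrr eqxx andbT; apply/eqP; field.
by rewrite !scalerDl unimodularD !unimodularU ?nmu ?sqrrN.
Qed.

(** Polar decomposition reduces to the scalar [|k|], which is an integer [n > |k|] times a real
    number in [0, 1]. *)
Lemma unimodularZ (k : R[i]) x : H (k *: x) = k *: H x.
Proof.
have [->|k0] := eqVneq k 0; first by rewrite !scale0r unimodular0.
have nk0 : `|k| != 0 by rewrite normr_eq0.
have [w w1 kE] : exists2 w : R[i], `|w| = 1 & k = w * `|k|.
  by exists (k / `|k|); rewrite ?divfK// normf_div normr_id divff.
suff Hr y : H (`|k| *: y) = `|k| *: H y by rewrite kE -!scalerA unimodularU// Hr.
have c0 := cabs_ge0 k; pose n := Num.bound (cabs k).
have cn : cabs k < n%:R by exact: archi_boundP.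
have n0 : n%:R != 0 :> R by rewrite gt_eqF// (le_lt_trans c0).
have -> : `|k| = n%:R * (cabs k / n%:R)%:C.
  rewrite cabsE -[n%:R in RHS](rmorph_nat (real_complex R)) -rmorphM.
  by rewrite mulrCA divff// mulr1.
rewrite -!scalerA unimodular_nat unimodular_real//; first by rewrite divr_ge0.
have n1 : 0 < n%:R :> R by exact: le_lt_trans c0 cn.
by rewrite ler_pdivrMr//; lra.
Qed.

End UnimodularLinear.

(** * Stability *)

Section Stability.
Local Open Scope complex_scope.
Variables (R : realType) (A B : cstar_algebra R) (X : hilmod A) (Y : hilmod B).
Variables (f : X -> Y) (phi : X -> X -> X -> R) (L : R).
Hypothesis phi_ge0 : forall x y z, 0 <= phi x y z.
Hypothesis f_lin : forall (mu : R[i]) (x y : X), `|mu| = 1 ->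
  hm_norm (f (mu *: x + y) - mu *: f x - f y) <= phi x y 0.
Hypothesis f_mul : forall x y z : X,
  hm_norm (f (hm_act (hm_ip x y) z) - hm_act (hm_ip (f x) (f y)) (f z))
    <= phi x y z.
Hypotheses (L0 : 0 <= L) (L1 : L < 1).
Hypothesis phi_contr : forall x y z : X,
  phi x y z <= L / 8 * phi (2 *: x) (2 *: y) (2 *: z).
Let nx := hm_norm_axioms Y.
Local Notation nrm := (@hm_norm R B Y).

Definition shrink n (x : X) : X := (2^-1 : R[i]) ^+ n *: x.
Definition approx (x : X) n : Y := (2 : R[i]) ^+ n *: f (shrink n x).

Lemma quarter_bounds : 0 <= L / 4 /\ L / 4 < 1.
Proof. by have := L0; have := L1; split; lra. Qed.

Lemma shrink0 n : shrink n 0 = 0.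
Proof. exact: scaler0. Qed.

Lemma shrinkS n x : 2 *: shrink n.+1 x = shrink n x.
Proof. by rewrite /shrink scalerA exprS mulrA divff ?mul1r// pnatr_eq0. Qed.

Lemma phi_shrink n x y z :
  phi (shrink n x) (shrink n y) (shrink n z) <= (L / 8) ^+ n * phi x y z.
Proof.
elim: n => [|n IH]; first by rewrite /shrink !expr0 !scale1r mul1r.
apply: le_trans (phi_contr _ _ _) _; rewrite !shrinkS exprS -(mulrA (L / 8)).
by rewrite ler_wpM2l// divr_ge0.
Qed.

Lemma nrm_expr2 n (v : Y) : nrm ((2 : R[i]) ^+ n *: v) = 2 ^+ n * nrm v.
Proof.
rewrite hm_normZ; congr (_ * _).
have -> : (2 : R[i]) ^+ n = (2 ^+ n)%:C by rewrite rmorphXn rmorph_nat.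
by rewrite cabs_real// exprn_ge0.
Qed.

(** The factor [2 ^+ n] against the decay [(L / 8) ^+ n] leaves [(L / 4) ^+ n]. The constant [c] is
    1 for linearity and [L / (8 - 8 L)] for uniqueness. *)
Lemma null_phi2 c x y : 0 <= c ->
  null_seq (fun n => 2 ^+ n * (c * phi (shrink n x) (shrink n y) 0)).
Proof.
move=> c0; have [q0 q1] := quarter_bounds.
apply: null_seq_le (null_seqM (mulr_ge0 c0 (phi_ge0 x y 0)) (null_seq_expr q0 q1)).
move=> n; have := phi_shrink n x y 0; rewrite shrink0 => le_phi.
have -> : c * phi x y 0 * (L / 4) ^+ n = 2 ^+ n * (c * ((L / 8) ^+ n * phi x y 0)).
  rewrite (_ : L / 4 = 2 * (L / 8)); last by field.
  by rewrite exprMn; ring.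
by rewrite ler_wpM2l ?exprn_ge0// ler_wpM2l.
Qed.

Lemma approx_incr x n : nrm (approx x n.+1 - approx x n) <=
  L / 8 * phi x x 0 * (L / 4) ^+ n.
Proof.
set w := shrink n.+1 x.
(* The increment is the additive defect of [f] at the pair [(w, w)], with scalar [mu = 1]. *)
have -> : approx x n.+1 - approx x n =
    - ((2 : R[i]) ^+ n *: (f (1 *: w + w) - 1 *: f w - f w)).
  have -> : 1 *: w + w = shrink n x by rewrite -shrinkS scaler_nat mulr2n scale1r.
  rewrite scale1r -(addrA (f _)) -opprD -(scalerN _ (f _ - _)) opprB scalerBr.
  by rewrite /approx -/w exprSr -scalerA scaler_nat mulr2n.
rewrite (norm_axN nx) nrm_expr2.
have le_phi : phi w w 0 <= (L / 8) ^+ n.+1 * phi x x 0.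
  by have := phi_shrink n.+1 x x 0; rewrite shrink0.
have -> : L / 8 * phi x x 0 * (L / 4) ^+ n = 2 ^+ n * ((L / 8) ^+ n.+1 * phi x x 0).
  rewrite (_ : L / 4 = 2 * (L / 8)); last by field.
  by rewrite exprMn exprS; ring.
by rewrite ler_wpM2l ?exprn_ge0// (le_trans _ le_phi)// f_lin// normr1.
Qed.

Lemma approx_limit x : exists l, tends_to nrm (approx x) l /\
  nrm (f x - l) <= L / (8 - 8 * L) * phi x x 0.
Proof.
have l0 := L0; have l1 := L1; set K := L / 8 / (1 - L / 4) * phi x x 0.
have K0 : 0 <= K by rewrite mulr_ge0// !divr_ge0//; lra.
have [q0 q1] := quarter_bounds.
have incr n : nrm (approx x n.+1 - approx x n) <=
    K * (L / 4) ^+ n - K * (L / 4) ^+ n.+1.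
  apply: le_trans (approx_incr x n) _; rewrite exprS /K le_eqVlt; apply/orP; left.
  by apply/eqP; field; apply/eqP; lra.
have r_ge0 n : 0 <= K * (L / 4) ^+ n by rewrite mulr_ge0// exprn_ge0.
have [l [lim le_l]] := dominated_tends_to nx incr r_ge0 (@hm_norm_complete _ _ Y)
  (null_seqM K0 (null_seq_expr q0 q1)).
exists l; split=> //; move: le_l; rewrite (norm_axC nx) mulr1.
rewrite /approx /shrink !expr0 !scale1r => /le_trans; apply.
(* The geometric sum has the constant [L / (8 - 2 L)], at most [L / (8 - 8 L)]. *)
rewrite /K ler_wpM2r// -mulrA ler_wpM2l// -invfM lef_pV2 ?posrE; lra.
Qed.

(** * The limit map is a homomorphism *)

Section Limit.
Variable H : X -> Y.
Hypothesis H_lim : forall x, tends_to nrm (approx x) (H x).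

Lemma limit_unimodular (mu : R[i]) x y : `|mu| = 1 ->
  H (mu *: x + y) = mu *: H x + H y.
Proof.
move=> mu1; apply: (tends_to_unique nx (H_lim _)).
apply: (tends_to_near nx (v := fun n => mu *: approx x n + approx y n)).
  apply: null_seq_le (null_phi2 x y ler01) => n; rewrite mul1r.
  have -> : approx (mu *: x + y) n - (mu *: approx x n + approx y n) =
      (2 : R[i]) ^+ n *: (f (mu *: shrink n x + shrink n y)
        - mu *: f (shrink n x) - f (shrink n y)).
    rewrite !scalerBr opprD addrA /approx /shrink.
    by rewrite scalerDr !scalerA !(mulrC mu).
  by rewrite nrm_expr2 ler_wpM2l ?exprn_ge0// f_lin.
apply: (tends_toD nx) (H_lim y).
apply: null_seq_le (H_lim x) => n.
by rewrite -scalerBr hm_normZ /cabs mu1 mul1r.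
Qed.

(** By degree 3, shrinking [hm_act (hm_ip x y) z] by [3 * n] halvings amounts to shrinking each
    argument by [n]. The defect of [f] is thus multiplied by [8 ^+ n] and bounded by
    [L ^+ n * phi x y z]. *)
Lemma limit_triple x y z :
  H (hm_act (hm_ip x y) z) = hm_act (hm_ip (H x) (H y)) (H z).
Proof.
apply: (tends_to_unique nx (u := fun n => approx (hm_act (hm_ip x y) z) (3 * n)%N)).
  by apply: tends_to_subseq (H_lim _) => n; rewrite leq_pmull.
apply: (tends_to_near nx) (hm_tends_to_triple (H_lim x) (H_lim y) (H_lim z)).
apply: null_seq_le (null_seqM (phi_ge0 x y z) (null_seq_expr L0 L1)) => n.
have e3 : shrink (3 * n) (hm_act (hm_ip x y) z) =
    hm_act (hm_ip (shrink n x) (shrink n y)) (shrink n z).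
  by rewrite /shrink hm_tripleZ ?rmorphXn ?fmorphV ?rmorph_nat// -exprM mulnC.
have -> : approx (hm_act (hm_ip x y) z) (3 * n) -
    hm_act (hm_ip (approx x n) (approx y n)) (approx z n) =
  (2 : R[i]) ^+ (3 * n) *: (f (hm_act (hm_ip (shrink n x) (shrink n y)) (shrink n z))
    - hm_act (hm_ip (f (shrink n x)) (f (shrink n y))) (f (shrink n z))).
  rewrite scalerBr {1}/approx e3; congr (_ - _).
  by rewrite /approx hm_tripleZ ?rmorphXn ?rmorph_nat// -exprM mulnC.
rewrite nrm_expr2.
have -> : phi x y z * L ^+ n = 2 ^+ (3 * n) * ((L / 8) ^+ n * phi x y z).
  rewrite {1}(_ : L = 2 ^+ 3 * (L / 8)); last by field.
  by rewrite exprMn -exprM; ring.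
by rewrite ler_wpM2l ?exprn_ge0// (le_trans (f_mul _ _ _))// phi_shrink.
Qed.

Lemma limit_hom : hilmod_hom H.
Proof.
split; [exact: (unimodularD limit_unimodular)|split; [|exact: limit_triple]].
exact: (unimodularZ limit_unimodular).
Qed.

End Limit.

(** Homogeneity gives [H x = 2 ^+ n *: H (shrink n x)], so the distance to [approx x n] is [2 ^+ n]
    times the error at [shrink n x]. Uniqueness of limits then gives uniqueness of the
    homomorphism. *)
Lemma near_hom_limit (H : X -> Y) (c : R) : 0 <= c -> hilmod_hom H ->
  (forall x, nrm (f x - H x) <= c * phi x x 0) ->
  forall x, tends_to nrm (approx x) (H x).
Proof.
move=> c0 [_ [HZ _]] fH x; apply: null_seq_le (null_phi2 x x c0) => n.
have -> : approx x n - H x = (2 : R[i]) ^+ n *: (f (shrink n x) - H (shrink n x)).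
  rewrite scalerBr -HZ /shrink scalerA -exprMn divff ?pnatr_eq0//.
  by rewrite expr1n scale1r.
by rewrite nrm_expr2 ler_wpM2l ?exprn_ge0.
Qed.

End Stability.

Theorem theorem2p4 (R : realType) (A B : cstar_algebra R)
  (X : hilmod A) (Y : hilmod B) (f : X -> Y) (phi : X -> X -> X -> R) :
  (forall x y z : X, 0 <= phi x y z) ->
  (forall (mu : R[i]) (x y : X), `|mu| = 1 ->
     hm_norm (f (mu *: x + y) - mu *: f x - f y) <= phi x y 0) ->
  (forall x y z : X,
     hm_norm (f (hm_act (hm_ip x y) z) - hm_act (hm_ip (f x) (f y)) (f z))
       <= phi x y z) ->
  forall L : R, 0 <= L -> L < 1 ->
  (forall x y z : X, phi x y z <= L / 8 * phi (2 *: x) (2 *: y) (2 *: z)) ->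
  exists! H : X -> Y, hilmod_hom H /\
    (forall x : X, hm_norm (f x - H x) <= L / (8 - 8 * L) * phi x x 0).
Proof.
move=> phi0 f_lin f_mul L L0 L1 contr.
have [H HP] := choice (approx_limit phi0 f_lin L0 L1 contr).
exists H; split.
  split; last by move=> x; case: (HP x).
  by apply: (limit_hom phi0 f_lin f_mul L0 L1 contr) => x; case: (HP x).
move=> H' [H'hom H'le]; apply/funext => x.
apply: (tends_to_unique (hm_norm_axioms Y) (HP x).1).
apply: (near_hom_limit phi0 L0 L1 contr _ H'hom H'le).
by rewrite divr_ge0//; lra.
Qed.
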